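(* Let $(\lambda,x_R,x_L)$ be a simple eigentriplet of $A\in\mathbb{C}^{n\times n}$ with $\|x_L\|=\|x_R\|=1$. Let $V_m$ be sketch-orthonormal, let $S$ be an $\epsilon$-subspace embedding for $\operatorname{span}([V_m,AV_m])$ with $\epsilon\in(0,1)$, let $\tau\notin\lambda(A)$, and let $\theta_m$ be the sketched harmonic Ritz value targeting $\lambda$, with $\mu_m=(\theta_m-\tau)^{-1}$ and $\|S\widehat u_m\|=1$, where $\widehat u_m$ is the associated Ritz vector for $(A-\tau I)^{-1}$. Let $\mu_*=(\lambda-\tau)^{-1}$. Assume that the uniform separation condition holds with constant $\beta_R>0$ for the sketched Rayleigh-Ritz projection of $(A-\tau I)^{-1}$ onto $\operatorname{span}((A-\tau I)V_m)$, represented in an $S$-orthonormal basis, and that $|\mu_m-\mu_*|\le|\mu_*|/2$. Then, with $\rho_m=\sin\angle(x_R,V_m)$, $$|\theta_m-\lambda|\le L_\theta\,\rho_m,\qquad L_\theta=\frac{2\kappa_2(A-\tau I)\,C_R\,M_\lambda}{1-\epsilon},$$ where $$C_R=\sqrt{1+K_\epsilon\|(A-\tau I)^{-1}-\mu_*I\|^2/\beta_R^2},\qquad K_\epsilon=\frac{1+\epsilon}{1-\epsilon},\qquad M_\lambda=\nu(\lambda)+(1+\epsilon)\|A-\lambda I\|,$$ and $\nu(\lambda)=\|(A^*-\bar\lambda I)x_R\|$.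
   Context: Notation: $\|\cdot\|$ is the Euclidean/spectral norm; $\kappa_2(\cdot)=\sigma_{\max}/\sigma_{\min}$; $\lambda(A)$ is the spectrum; $\operatorname{span}(V)$ is the column space. For nonzero $x$ and a matrix $W$, $\sin\angle(x,W)=\min_{w\in\operatorname{span}(W)}\|x-w\|/\|x\|$. Eigentriplet: $\lambda$ is simple, $Ax_R=\lambda x_R$, $x_L^*A=\lambda x_L^*$. Sketching: $S\in\mathbb{C}^{s\times n}$ is an $\epsilon$-subspace embedding for a subspace $\mathcal V$ if $(1-\epsilon)\|u\|^2\le\|Su\|^2\le(1+\epsilon)\|u\|^2$ for all $u\in\mathcal V$. $V$ is sketch-orthonormal (or $S$-orthonormal) if $(SV)^*(SV)=I$. Sketched harmonic extraction: $(\theta_m,y_m)$, $y_m\ne0$, $\theta_m\neq\tau$, solves $$(S(A-\tau I)V_m)^*(S(A-\tau I)V_m)y=(\theta-\tau)(S(A-\tau I)V_m)^*(SV_m)y,$$ the pair being selected to target $\lambda$. Equivalently $\mu_m$ is a sketched Ritz value of $(A-\tau I)^{-1}$ on $\operatorname{span}((A-\tau I)V_m)$ with Ritz vector $\widehat u_m=(A-\tau I)V_my_m$ (scaled so that $\|S\widehat u_m\|=1$). Uniform separation condition: let $Q$ be an $S$-orthonormal basis of $\operatorname{span}((A-\tau I)V_m)$, $H^R=(SQ)^*(S(A-\tau I)^{-1}Q)$, and $\widehat u_m=Qz_m$, so that $H^Rz_m=\mu_mz_m$, $\|z_m\|=1$. Extending $z_m$ to a unitary $[z_m,Z_\perp]$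 and writing $[z_m,Z_\perp]^*H^R[z_m,Z_\perp]=\begin{bmatrix}\mu_m&H_{12}\\0&H_{22}\end{bmatrix}$, the condition with constant $\beta_R$ is $\sigma_{\min}(H_{22}-\mu_*I)\ge\beta_R$. *)

(* Defs.v *)
From mathcomp Require Export all_boot all_order all_algebra.
From mathcomp Require Export complex spectral.
From mathcomp Require Export boolp classical_sets reals constructive_ereal ereal.

Set Implicit Arguments.
Unset Strict Implicit.
Unset Printing Implicit Defensive.

Import Order.TTheory GRing.Theory Num.Theory.
Export Normc.

Local Open Scope ring_scope.
Local Open Scope classical_set_scope.
Local Open Scope sesquilinear_scope.

(* The complex numbers are R[i]; all norms, singular values and angles are
   real numbers (elements of R), with [normc] the modulus. *)

Definition norm2 (R : realType) (n : nat) (x : 'cV[R[i]]_n) : R :=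
  Num.sqrt (\sum_(i < n) normc (x i 0) ^+ 2).

Definition spectral_norm (R : realType) (p n : nat) (M : 'M[R[i]]_(p, n)) : R :=
  sup [set norm2 (M *m x) | x in [set x : 'cV[R[i]]_n | norm2 x = 1]].

Definition singular_values (R : realType) (n : nat) (M : 'M[R[i]]_n) : set R :=
  [set t | 0 <= t /\ eigenvalue (M^t* *m M) (real_complex R (t ^+ 2))].

Definition sigma_max (R : realType) (n : nat) (M : 'M[R[i]]_n) : R :=
  sup (singular_values M).

(* Extended-real valued, so that the smallest singular value of the empty
   0 x 0 matrix is +oo. *)
Definition sigma_min (R : realType) (n : nat) (M : 'M[R[i]]_n) : \bar R :=
  ereal_inf [set t%:E | t in singular_values M].

Definition kappa2 (R : realType) (n : nat) (M : 'M[R[i]]_n) : R :=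
  sigma_max M / fine (sigma_min M).

Definition colspan (R : realType) (n k : nat) (M : 'M[R[i]]_(n, k)) :
    set 'cV[R[i]]_n :=
  [set M *m c | c in [set: 'cV[R[i]]_k]].

(* The minimum over the (closed) subspace is attained, hence is an infimum. *)
Definition sin_angle (R : realType) (n k : nat)
    (x : 'cV[R[i]]_n) (M : 'M[R[i]]_(n, k)) : R :=
  inf [set norm2 (x - w) / norm2 x | w in colspan M].

Definition simple_eigentriplet (R : realType) (n : nat) (A : 'M[R[i]]_n)
    (lam : R[i]) (xR xL : 'cV[R[i]]_n) : Prop :=
  [/\ mup lam (char_poly A) = 1%N,
      xR != 0, xL != 0,
      A *m xR = lam *: xR &
      xL^t* *m A = lam *: xL^t*].

Definition subspace_embedding (R : realType) (s n : nat)
    (S : 'M[R[i]]_(s, n)) (eps : R) (E : set 'cV[R[i]]_n) : Prop :=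
  forall u, E u ->
    (1 - eps) * norm2 u ^+ 2 <= norm2 (S *m u) ^+ 2 <= (1 + eps) * norm2 u ^+ 2.

Definition sketch_orthonormal (R : realType) (s n k : nat)
    (S : 'M[R[i]]_(s, n)) (V : 'M[R[i]]_(n, k)) : Prop :=
  (S *m V)^t* *m (S *m V) = 1%:M.

Definition sketched_harmonic_pair (R : realType) (s n k : nat)
    (S : 'M[R[i]]_(s, n)) (A : 'M[R[i]]_n) (V : 'M[R[i]]_(n, k)) (tau : R[i])
    (theta : R[i]) (y : 'cV[R[i]]_k) : Prop :=
  let SW := S *m ((A - tau%:M) *m V) in
  [/\ y != 0, theta != tau &
      SW^t* *m SW *m y = (theta - tau) *: (SW^t* *m (S *m V) *m y)].

(* Separation with constant beta of the eigenvalue mu (Ritz vector u) of the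
   sketched Rayleigh-Ritz projection of B onto span(W), relative to mustar.
   The number of columns of W is written m.+1: it is positive as soon as there
   is a Ritz vector. *)
Definition separation_condition (R : realType) (s n m : nat)
    (S : 'M[R[i]]_(s, n)) (B : 'M[R[i]]_n) (W : 'M[R[i]]_(n, m.+1))
    (mu : R[i]) (u : 'cV[R[i]]_n) (mustar : R[i]) (beta : R) : Prop :=
  exists (Q : 'M[R[i]]_(n, m.+1)) (z : 'cV[R[i]]_m.+1)
         (Zperp : 'M[R[i]]_(m.+1, m))
         (H12 : 'M[R[i]]_(1, m)) (H22 : 'M[R[i]]_m),
    let U : 'M[R[i]]_m.+1 := row_mx z Zperp in
    let HR : 'M[R[i]]_m.+1 := (S *m Q)^t* *m (S *m (B *m Q)) in
    [/\ sketch_orthonormal S Q /\ colspan Q = colspan W,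
        u = Q *m z,
        U \is unitarymx,
        U^t* *m HR *m U = block_mx mu%:M H12 0 H22 &
        (beta%:E <= sigma_min (H22 - mustar%:M))%E].

(* Main.v *)
(* With B = (A - tau I)^-1, the vector xR is an eigenvector of B for mustar, and
   (A - tau I) maps the approximation error of xR in span(V) to its
   approximation error in W = span((A - tau I) V) at the cost of a factor
   |mustar| sigma_max(A - tau I).  Projecting xR orthogonally onto W and reading
   the eigenvector residual in the S-orthonormal basis [z, Zperp] bounds the
   Zperp component through the separation condition, so xR is within
   CR dist(xR, W) of the line of the Ritz vector u.  Since
   mu - mustar = (S u)^* S (B - mustar I) u and
   B - mustar I = - mustar B (A - lam I), this gives a bound on |mu - mustar|
   with a second factor |mustar|, and the two factors cancel the one in
   |theta - lam| <= 2 |mu - mustar| / |mustar|^2.  S is only ever applied to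
   vectors of W and of span(V), never to xR. *)
From mathcomp Require Import ring lra.
Require Import Defs.
Import Order.TTheory GRing.Theory Num.Theory.
Local Open Scope ring_scope.
Local Open Scope sesquilinear_scope.

Set Implicit Arguments.
Unset Strict Implicit.
Unset Printing Implicit Defensive.

(** * Adjoints, the Euclidean norm and orthogonality *)

Lemma adjmxM (C : numClosedFieldType) p q r (M : 'M[C]_(p, q)) (N : 'M[C]_(q, r)) :
  (M *m N)^t* = N^t* *m M^t*.
Proof. by rewrite trmx_mul map_mxM. Qed.

Lemma adjmxD (C : numClosedFieldType) p q (M N : 'M[C]_(p, q)) :
  (M + N)^t* = M^t* + N^t*.
Proof. by rewrite [(M + N)^T]linearD map_mxD. Qed.

Lemma adjmxZ (C : numClosedFieldType) p q a (M : 'M[C]_(p, q)) :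
  (a *: M)^t* = a^* *: M^t*.
Proof. by rewrite [(a *: M)^T]linearZ map_mxZ. Qed.

Section EuclideanNorm.
Variable R : realType.

Lemma normc_ge0 (z : R[i]) : 0 <= normc z.
Proof. by case: z => a b; exact: sqrtr_ge0. Qed.

Lemma normcCE (z : R[i]) : real_complex R (normc z) = `|z|.
Proof. by []. Qed.

Lemma normcC2 (z : R[i]) : real_complex R (normc z ^+ 2) = z^* * z.
Proof. by rewrite rmorphXn /= normcCE normCKC. Qed.

Lemma norm2_ge0 n (x : 'cV[R[i]]_n) : 0 <= norm2 x.
Proof. exact: sqrtr_ge0. Qed.

Lemma norm2_sqr n (x : 'cV[R[i]]_n) : norm2 x ^+ 2 = \sum_i normc (x i 0) ^+ 2.
Proof. by rewrite sqr_sqrtr // sumr_ge0 // => i _; exact: sqr_ge0. Qed.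

(** Identities between real norms are proved in [R[i]] through this form and pulled back along the
    injection [real_complex]. *)
Lemma norm2_sqrC n (x : 'cV[R[i]]_n) :
  real_complex R (norm2 x ^+ 2) = (x^t* *m x) 0 0.
Proof.
rewrite norm2_sqr rmorph_sum mxE /=; apply: eq_bigr => i _.
by rewrite normcC2 !mxE.
Qed.

Lemma norm2_eq0 n (x : 'cV[R[i]]_n) : (norm2 x == 0) = (x == 0).
Proof.
apply/eqP/eqP => [x0|->]; last first.
  by rewrite /norm2 big1 ?sqrtr0 // => i _; rewrite mxE normc0 expr0n.
apply/matrixP => i j; rewrite ord1 mxE; apply: eq0_normc; apply/eqP.
have : \sum_i normc (x i 0) ^+ 2 == 0 by rewrite -norm2_sqr x0 expr0n.
rewrite psumr_eq0 => [/allP/(_ i)|k _]; last exact: sqr_ge0.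
by rewrite mem_index_enum /= sqrf_eq0 => /(_ isT).
Qed.

Lemma norm2_gt0 n (x : 'cV[R[i]]_n) : (0 < norm2 x) = (x != 0).
Proof. by rewrite lt_def norm2_ge0 andbT norm2_eq0. Qed.

Lemma norm2_0 n : norm2 (0 : 'cV[R[i]]_n) = 0.
Proof. by apply/eqP; rewrite norm2_eq0. Qed.

Lemma norm2Z n (a : R[i]) (x : 'cV[R[i]]_n) : norm2 (a *: x) = normc a * norm2 x.
Proof.
rewrite /norm2 -[normc a in RHS]ger0_norm ?normc_ge0 // -sqrtr_sqr.
rewrite -sqrtrM ?sqr_ge0 //; congr Num.sqrt.
rewrite mulr_sumr; apply: eq_bigr => i _.
by rewrite mxE normcM exprMn.
Qed.

Lemma norm2_isometry p n (T : 'M[R[i]]_(p, n)) (x : 'cV[R[i]]_n) :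
  T^t* *m T = 1%:M -> norm2 (T *m x) = norm2 x.
Proof.
move=> TT; apply/eqP; rewrite -(@eqrXn2 _ 2) ?norm2_ge0 //; apply/eqP.
apply: (@complexI R); rewrite !norm2_sqrC adjmxM -mulmxA (mulmxA (T^t*)) TT.
by rewrite mul1mx.
Qed.

Lemma norm2D_sqr n (x y : 'cV[R[i]]_n) : x^t* *m y = 0 ->
  norm2 (x + y) ^+ 2 = norm2 x ^+ 2 + norm2 y ^+ 2.
Proof.
move=> xy0; have yx0 : y^t* *m x = 0.
  by rewrite -[y^t* *m x]trmxCK adjmxM trmxCK xy0 trmx0 map_mx0.
apply: (@complexI R); rewrite rmorphD /= !norm2_sqrC adjmxD.
by rewrite mulmxDl !mulmxDr xy0 yx0 addr0 add0r mxE.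
Qed.

(** Pythagoras for [w] split into its orthogonal projection [T *m (T^t* *m w)], which has the norm
    of [T^t* *m w], and the remainder. *)
Lemma norm2_adj_isometry p n (T : 'M[R[i]]_(p, n)) (w : 'cV[R[i]]_p) :
  T^t* *m T = 1%:M -> norm2 (T^t* *m w) <= norm2 w.
Proof.
move=> TT; rewrite -ler_sqr ?nnegrE ?norm2_ge0 //.
rewrite -{2}[w](subrKC (T *m (T^t* *m w))) norm2D_sqr.
  by rewrite (norm2_isometry _ TT) lerDl sqr_ge0.
by rewrite adjmxM mulmxBr -!mulmxA (mulmxA (T^t*) T) TT mul1mx subrr.
Qed.

Lemma norm2_cV1 (x : 'cV[R[i]]_1) : norm2 x = normc (x 0 0).
Proof. by rewrite /norm2 big_ord1 sqrtr_sqr ger0_norm ?normc_ge0. Qed.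

(* The two sides compare the angle between [x] and [u] measured from either
   vector. *)
Lemma norm2_sub_proj n (x u : 'cV[R[i]]_n) (g : R[i]) : norm2 x = 1 ->
  norm2 (u - (x^t* *m u) 0 0 *: x) <= norm2 u * norm2 (x - g *: u).
Proof.
move=> x1; set a := _ 0 0; set p := u - _.
have xp : x^t* *m p = 0.
  rewrite mulmxBr -scalemxAr [x^t* *m u]mx11_scalar [x^t* *m x]mx11_scalar.
  by rewrite -norm2_sqrC x1 expr1n scale_scalar_mx mulr1 subrr.
have uE : u = a *: x + p by rewrite /p subrKC.
have axp b c : norm2 (b *: x + c *: p) ^+ 2 =
    normc b ^+ 2 + normc c ^+ 2 * norm2 p ^+ 2.
  rewrite norm2D_sqr ?norm2Z ?x1 ?mulr1 ?exprMn //.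
  by rewrite adjmxZ -scalemxAl -scalemxAr xp !scaler0.
rewrite -ler_sqr ?nnegrE ?mulr_ge0 ?norm2_ge0 //.
have -> : x - g *: u = (1 - g * a) *: x + (- g) *: p.
  by rewrite {1}uE scalerDr scalerA opprD addrA scalerBl scale1r scaleNr.
rewrite exprMn {1}uE -[p in a *: x + p]scale1r !axp normcN normc1 expr1n mul1r.
(* As [(1 - g * a) + g * a = 1], the triangle inequality ties the coordinates of [x - g *: u] to
   those of [u]. *)
have : normc 1 <= normc (1 - g * a) + normc g * normc a.
  by rewrite -normcM; apply: le_trans (le_normcD _ _); rewrite subrK.
rewrite normc1.
have := normc_ge0 a; have := normc_ge0 g; have := normc_ge0 (1 - g * a).
have := norm2_ge0 p.
move: (normc a) (normc g) (normc (1 - g * a)) (norm2 p) => A G D P P0 D0 G0 A0 h.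
(* Cauchy-Schwarz for (P, A) and (D, G P) *)
have h1 : P ^+ 2 <= (P * (D + G * A)) ^+ 2.
  rewrite ler_sqr ?nnegrE ?mulr_ge0 ?addr_ge0 ?mulr_ge0 //.
  exact: ler_peMr.
apply: (le_trans h1); have := sqr_ge0 (P * (G * P) - A * D); lra.
Qed.

(** Injectivity of [Q] makes its Gram matrix invertible, since a kernel vector [v] satisfies
    [norm2 (Q *m v) = 0]; then [c] solves the normal equations. *)
Lemma orthogonal_residual p n (Q : 'M[R[i]]_(n, p)) (x : 'cV[R[i]]_n) :
  (forall c : 'cV_p, Q *m c = 0 -> c = 0) ->
  exists c, Q^t* *m (x - Q *m c) = 0.
Proof.
move=> Qinj; have QQ : Q^t* *m Q \in unitmx.
  rewrite -unitmx_tr -row_free_unit -kermx_eq0; apply/eqP/row_matrixP => i.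
  rewrite row0; set v := row i _.
  have /(congr1 (fun M => M^T)) : v *m (Q^t* *m Q)^T = 0.
    by rewrite -row_mul mulmx_ker row0.
  rewrite trmx_mul trmxK trmx0 => h; apply/trmx_inj; rewrite trmx0; apply: Qinj.
  apply/eqP; rewrite -norm2_eq0 -sqrf_eq0; apply/eqP/(@complexI R).
  by rewrite norm2_sqrC adjmxM -mulmxA (mulmxA (Q^t*)) h mulmx0 mxE.
exists (invmx (Q^t* *m Q) *m (Q^t* *m x)).
by rewrite mulmxBr (mulmxA (Q^t*) Q) mulmxA mulmxV // mul1mx subrr.
Qed.

End EuclideanNorm.

(** * Singular values and the spectral norm *)

Section SingularValues.
Variable R : realType.

(** The right half of an SVD, from the spectral theorem for the normal matrix [M^t* *m M]: the
    adjoints of the rows of [P] are right singular vectors. *)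
Lemma singular_value_decomposition n (M : 'M[R[i]]_n) :
  exists (P : 'M[R[i]]_n) (t : 'I_n -> R),
    [/\ P^t* *m P = 1%:M, forall i, singular_values M (t i) &
        forall v, norm2 (M *m v) ^+ 2 =
                  \sum_i t i ^+ 2 * normc ((P *m v) i 0) ^+ 2].
Proof.
set G := M^t* *m M.
have /orthomx_spectralP GE : G \is normalmx.
  by apply/normalmxP; rewrite /G adjmxM trmxCK.
move: GE; set P := spectralmx G; set D := spectral_diag G => GE.
have PU : P \is unitarymx := spectral_unitarymx G.
have PiE := invmx_unitary PU.
have PP : P^t* *m P = 1%:M by rewrite -PiE mulVmx // unitarymx_unit.
have PG : P *m G = diag_mx D *m P.
  by rewrite {1}GE !mulmxA mulmxV ?unitarymx_unit // mul1mx.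
(* Taking [t i] as a norm gives its sign for free, and [tD] then shows that the spectral diagonal is
   real and nonnegative. *)
pose t i := norm2 (M *m (row i P)^t*).
have rowP1 i : (row i P *m (row i P)^t*) 0 0 = 1.
  move/unitarymxP: PU => /(congr1 (fun N : 'M_n => N i i)).
  rewrite !mxE eqxx mulr1n => <-; by apply: eq_bigr => j _; rewrite !mxE.
have rowG i : row i P *m G = D 0 i *: row i P.
  by rewrite -row_mul PG row_mul row_diag_mx -scalemxAl -rowE.
have tD i : real_complex R (t i ^+ 2) = D 0 i.
  rewrite norm2_sqrC adjmxM trmxCK -!mulmxA (mulmxA (M^t*)) -/G mulmxA rowG.
  by rewrite -scalemxAl mxE rowP1 mulr1.
exists P, t; split=> // [i|v].
  split; first exact: norm2_ge0.
  rewrite tD; apply/eigenvalueP; exists (row i P) => //.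
  apply/eqP => r0; have := rowP1 i; rewrite r0 mul0mx mxE => /esym/eqP.
  by rewrite oner_eq0.
apply: (@complexI R); rewrite norm2_sqrC adjmxM -mulmxA (mulmxA (M^t*)) -/G GE.
rewrite PiE -!mulmxA mulmxA -adjmxM mul_diag_mx mxE rmorph_sum /=.
apply: eq_bigr => i _; rewrite rmorphM /= tD normcC2 !mxE.
by rewrite mulrCA.
Qed.

(** [eigenvalue] concerns row vectors; as the Gram matrix is Hermitian, the adjoint of such a row is
    a right singular vector. *)
Lemma singular_valueP n (M : 'M[R[i]]_n) t : singular_values M t ->
  exists2 v, v != 0 & norm2 (M *m v) = t * norm2 v.
Proof.
move=> [t0 /eigenvalueP[r rE r0]]; exists (r^t*).
  by apply: contra r0 => /eqP r0; rewrite -[r]trmxCK r0 trmx0 map_mx0.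
apply/eqP; rewrite -(@eqrXn2 _ 2) ?mulr_ge0 ?norm2_ge0 //; apply/eqP.
apply: (@complexI R); rewrite exprMn [RHS]rmorphM /= [RHS]mulrC !norm2_sqrC adjmxM trmxCK mulrC.
by rewrite -!mulmxA (mulmxA (M^t*)) mulmxA rE -scalemxAl mxE.
Qed.

Lemma singular_values_has_ub n (M : 'M[R[i]]_n) : has_ubound (singular_values M).
Proof.
have [P [t [PP tM ME]]] := singular_value_decomposition M.
(* A crude bound suffices: the Frobenius norm of [M]. *)
exists (Num.sqrt (\sum_i t i ^+ 2)) => s sM.
have [v v0 Mv] := singular_valueP sM; case: sM => s0 _.
rewrite -[s]ger0_norm // -sqrtr_sqr ler_wsqrtr //.
have vgt0 : 0 < norm2 v ^+ 2 by rewrite exprn_gt0 ?norm2_gt0.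
rewrite -(ler_pM2r vgt0) -exprMn -Mv ME mulr_suml ler_sum // => i _.
rewrite ler_wpM2l ?sqr_ge0 // -(norm2_isometry v PP) norm2_sqr.
by rewrite (bigD1 i) //= lerDl sumr_ge0 // => j _; exact: sqr_ge0.
Qed.

Lemma singular_value_le_sigma_max n (M : 'M[R[i]]_n) t :
  singular_values M t -> t <= sigma_max M.
Proof. by apply: sup_ubound; exact: singular_values_has_ub. Qed.

Lemma norm2_le_sigma_max n (M : 'M[R[i]]_n) v :
  norm2 (M *m v) <= sigma_max M * norm2 v.
Proof.
have [P [t [PP tM ME]]] := singular_value_decomposition M.
have [->|v0] := eqVneq v 0; first by rewrite mulmx0 !norm2_0 mulr0.
have s0 : 0 <= sigma_max M.
  (* The sign of the supremum comes from an actual singular value, which exists only in positive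
     dimension; in dimension 0, [v] would be zero. *)
  case: n M v P t PP tM ME v0 => [|n] M v P t PP tM ME v0.
    by case/eqP: v0; apply/matrixP => -[].
  by have := singular_value_le_sigma_max (tM 0); apply: le_trans; case: (tM 0).
rewrite -ler_sqr ?nnegrE ?mulr_ge0 ?norm2_ge0 //.
rewrite ME exprMn -(norm2_isometry v PP) norm2_sqr mulr_sumr ler_sum // => i _.
rewrite ler_wpM2r ?sqr_ge0 // ler_sqr ?nnegrE //; last by case: (tM i).
exact: singular_value_le_sigma_max.
Qed.

(** A real lower bound [b] also covers the empty matrix, where [sigma_min] is [+oo]; this happens
    for [H22] when the search space has dimension one. *)
Lemma norm2_ge_sigma_min n (M : 'M[R[i]]_n) b v : 0 <= b ->
  (b%:E <= sigma_min M)%E -> b * norm2 v <= norm2 (M *m v).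
Proof.
move=> b0 bM; have [P [t [PP tM ME]]] := singular_value_decomposition M.
rewrite -ler_sqr ?nnegrE ?mulr_ge0 ?norm2_ge0 //.
rewrite ME exprMn -(norm2_isometry v PP) norm2_sqr mulr_sumr ler_sum // => i _.
rewrite ler_wpM2r ?sqr_ge0 // ler_sqr ?nnegrE //; last by case: (tM i).
by rewrite -lee_fin (le_trans bM) // ereal_inf_lbound //; exists (t i).
Qed.

(** Guarantees that [fine] in [kappa2] returns the true, positive value. The size [n.+1] provides a
    singular value, which excludes [+oo]. *)
Lemma sigma_min_unitmx n (M : 'M[R[i]]_n.+1) : M \in unitmx ->
  exists2 b : R, 0 < b & sigma_min M = b%:E.
Proof.
move=> Mu; have [P [t [_ tM _]]] := singular_value_decomposition M.
(* Apply [invmx M] to [M *m v] for a singular vector [v]: this bounds all singular values below by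
   [(sigma_max (invmx M))^-1]. *)
have st s : singular_values M s -> 1 <= sigma_max (invmx M) * s.
  move=> sM; have [v v0 Mv] := singular_valueP sM.
  have v_gt0 : 0 < norm2 v by rewrite norm2_gt0.
  have := norm2_le_sigma_max (invmx M) (M *m v).
  by rewrite mulmxA mulVmx // mul1mx Mv mulrA -{1}[norm2 v]mul1r ler_pM2r.
have b_gt0 : 0 < sigma_max (invmx M).
  have := st _ (tM 0); case: (tM 0) => t0 _ st0.
  rewrite ltNge; apply/negP => s0.
  by have := le_trans st0 (mulr_le0_ge0 s0 t0); rewrite ler10.
have lb : ((sigma_max (invmx M))^-1%:E <= sigma_min M)%E.
  apply: le_ereal_inf_tmp => _ [s sM <-].
  by rewrite lee_fin -[_^-1]mul1r ler_pdivrMr // mulrC st.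
have ub : (sigma_min M <= (t 0)%:E)%E.
  by apply: ereal_inf_lbound; exists (t 0).
case E : (sigma_min M) lb ub => [b| |] // lb _.
by exists b => //; rewrite lee_fin in lb; apply: lt_le_trans lb; rewrite invr_gt0.
Qed.

(** The set under the supremum is bounded by [sigma_max M], so the normalized [v] gives an element
    below it. *)
Lemma norm2_le_spectral_norm n (M : 'M[R[i]]_n) v :
  norm2 (M *m v) <= spectral_norm M * norm2 v.
Proof.
have [->|v0] := eqVneq v 0; first by rewrite mulmx0 !norm2_0 mulr0.
have v_gt0 : 0 < norm2 v by rewrite norm2_gt0.
rewrite -ler_pdivrMr //; apply: sup_ubound.
  by exists (sigma_max M) => _ [w /= w1 <-];
    rewrite -[X in _ <= X]mulr1 -w1 norm2_le_sigma_max.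
have nv : normc (real_complex R (norm2 v)^-1) = (norm2 v)^-1.
  by apply: (@complexI R); rewrite normcCE ger0_norm // ler0c invr_ge0 norm2_ge0.
exists (real_complex R (norm2 v)^-1 *: v) => /=.
  by rewrite norm2Z nv mulVf ?gt_eqF.
by rewrite -scalemxAr norm2Z nv mulrC.
Qed.

Lemma spectral_norm_ge0 n (M : 'M[R[i]]_n) : 0 <= spectral_norm M.
Proof.
rewrite /spectral_norm; set E := (X in sup X).
(* In dimension 0 there is no unit vector, and the supremum of the empty set is 0. *)
have [->|/set0P[_ [v /= v1 _]]] := eqVneq E set0; first by rewrite sup0.
have := norm2_le_spectral_norm M v; rewrite v1 mulr1; apply: le_trans.
exact: norm2_ge0.
Qed.

End SingularValues.

(** * Error of the Ritz vector *)

(** Unitarity turns the hypothesis into [U^t* *m H = T *m U^t*] with [T] the block matrix; its zero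
    block makes the rows of [Z^t*] span a left invariant subspace of [H]. *)
Lemma unitary_block_compression (C : numClosedFieldType) k p q
    (z : 'M[C]_(k, p)) (Z : 'M[C]_(k, q)) (H : 'M[C]_k) (a : 'M[C]_p)
    (H12 : 'M[C]_(p, q)) (H22 : 'M[C]_q) :
  row_mx z Z *m (row_mx z Z)^t* = 1%:M -> (row_mx z Z)^t* *m row_mx z Z = 1%:M ->
  (row_mx z Z)^t* *m H *m row_mx z Z = block_mx a H12 0 H22 ->
  [/\ z^t* *m H *m z = a, Z^t* *m H = H22 *m Z^t*, Z^t* *m Z = 1%:M &
      z *m z^t* + Z *m Z^t* = 1%:M].
Proof.
move=> UU UU' HU.
have HU' : (row_mx z Z)^t* *m H = block_mx a H12 0 H22 *m (row_mx z Z)^t*.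
  by rewrite -HU -mulmxA UU mulmx1.
move: UU UU' HU HU'; rewrite tr_row_mx map_col_mx mul_row_col mul_col_row.
rewrite scalar_mx_block mul_col_mx mul_col_row mul_block_col mul0mx add0r.
by move=> -> /eq_block_mx[_ _ _ ->] /eq_block_mx[-> _ _ _] /eq_col_mx[_ ->].
Qed.

Lemma ritz_vector_error (R : realType) n s m (S : 'M[R[i]]_(s, n))
    (B : 'M[R[i]]_n) (Q : 'M[R[i]]_(n, m.+1)) (z : 'cV[R[i]]_m.+1)
    (Zperp : 'M[R[i]]_(m.+1, m)) (mu mustar : R[i]) (H12 : 'M[R[i]]_(1, m))
    (H22 : 'M[R[i]]_m) (x : 'cV[R[i]]_n) (eps beta : R) (E : set 'cV[R[i]]_n) :
  let U : 'M[R[i]]_m.+1 := row_mx z Zperp in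
  let HR : 'M[R[i]]_m.+1 := (S *m Q)^t* *m (S *m (B *m Q)) in
  let CR := Num.sqrt (1 + (1 + eps) / (1 - eps) *
    spectral_norm (B - mustar%:M) ^+ 2 / beta ^+ 2) in
  0 < eps < 1 -> 0 < beta ->
  subspace_embedding S eps E ->
  (forall c, E (Q *m c)) -> (forall c, E ((B - mustar%:M) *m (Q *m c))) ->
  sketch_orthonormal S Q -> U \is unitarymx ->
  U^t* *m HR *m U = block_mx mu%:M H12 0 H22 ->
  (beta%:E <= sigma_min (H22 - mustar%:M))%E ->
  B *m x = mustar *: x ->
  exists g, forall c, norm2 (x - g *: (Q *m z)) <= CR * norm2 (x - Q *m c).
Proof.
move=> U HR CR /andP[e0 e1] b0 emb EQ EBQ SQ Uu HRU bH Bx.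
have Qinj (c : 'cV_m.+1) : Q *m c = 0 -> c = 0.
  move=> Qc; apply/eqP; rewrite -norm2_eq0 -(norm2_isometry c SQ) -mulmxA Qc.
  by rewrite mulmx0 norm2_0.
have [c cP] := orthogonal_residual x Qinj.
set q := x - Q *m c in cP.
have UU : U *m U^t* = 1%:M by apply/unitarymxP.
have UU' : U^t* *m U = 1%:M by apply: mulmx1C.
have [_ HZ ZZ zZ] :=
  @unitary_block_compression _ m.+1 1 m z Zperp HR _ _ _ UU UU' HRU.
set g := (z^t* *m c) 0 0; set d := Zperp^t* *m c.
have cE : c = g *: z + Zperp *m d.
  rewrite -{1}[c]mul1mx -zZ mulmxDl -!mulmxA.
  by rewrite [z^t* *m c]mx11_scalar mul_mx_scalar.
(* [B - mustar%:M] kills [x], so its values at the projection and at the residual [q] are opposite: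
   the sketch acts on the former, the norm bound on the latter. *)
have Bq : (B - mustar%:M) *m (Q *m c) = - ((B - mustar%:M) *m q).
  by rewrite /q mulmxBr [_ *m x]mulmxBl Bx mul_scalar_mx subrr sub0r opprK.
(* [H22 *m Zperp^t*] becomes [Zperp^t* *m HR], and S-orthonormality of [Q] lets the shift [mustar]
   pass inside the sketch. *)
have dH : (H22 - mustar%:M) *m d =
    Zperp^t* *m ((S *m Q)^t* *m (S *m ((B - mustar%:M) *m (Q *m c)))).
  rewrite mulmxBl mul_scalar_mx /d (mulmxA H22) -HZ /HR mulmxBl !mulmxBr.
  rewrite mul_scalar_mx -!scalemxAr -!mulmxA; congr (_ - _ *: (_ *m _)).
  by rewrite -[LHS]mul1mx -SQ -!mulmxA.
set N := spectral_norm _ in CR *.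
(* Separation below and the upper embedding inequality above give the numerator [1 + eps] of the
   constant; [hQ] gives the denominator [1 - eps]. *)
have hd : beta ^+ 2 * norm2 d ^+ 2 <= (1 + eps) * (N ^+ 2 * norm2 q ^+ 2).
  have h1 : beta * norm2 d <= norm2 (S *m ((B - mustar%:M) *m (Q *m c))).
    apply: le_trans (norm2_ge_sigma_min _ (ltW b0) bH) _; rewrite dH.
    exact: le_trans (norm2_adj_isometry _ ZZ) (norm2_adj_isometry _ SQ).
  have /andP[_ h2] := emb _ (EBQ c).
  rewrite -!exprMn; apply: le_trans (le_trans _ h2) _.
    by rewrite ler_sqr ?nnegrE ?mulr_ge0 ?norm2_ge0 ?(ltW b0).
  rewrite ler_wpM2l ?addr_ge0 ?(ltW e0) // ler_sqr ?nnegrE ?mulr_ge0 ?norm2_ge0 //; last first.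
    exact: spectral_norm_ge0.
  by rewrite Bq -scaleN1r norm2Z normcN normc1 mul1r norm2_le_spectral_norm.
have hQ : (1 - eps) * norm2 (Q *m (Zperp *m d)) ^+ 2 <= norm2 d ^+ 2.
  have /andP[+ _] := emb _ (EQ (Zperp *m d)).
  by rewrite (mulmxA S) (norm2_isometry _ SQ) (norm2_isometry _ ZZ).
have orth c' : norm2 (q + Q *m c') ^+ 2 = norm2 q ^+ 2 + norm2 (Q *m c') ^+ 2.
  rewrite norm2D_sqr // -[Q *m c']trmxCK -adjmxM (adjmxM Q) -mulmxA cP mulmx0.
  by rewrite trmx0 map_mx0.
have qmin c' : norm2 q <= norm2 (x - Q *m c').
  have -> : x - Q *m c' = q + Q *m (c - c').
    by rewrite mulmxBr /q addrA subrK.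
  by rewrite -ler_sqr ?nnegrE ?norm2_ge0 // orth lerDl sqr_ge0.
(* By [qmin] the residual [q] is shortest, so it is enough to compare with [norm2 q]. *)
exists g => c'; apply: (@le_trans _ _ (CR * norm2 q)); last first.
  by rewrite ler_wpM2l ?sqrtr_ge0.
have -> : x - g *: (Q *m z) = q + Q *m (Zperp *m d).
  by rewrite /q {1}cE mulmxDr -scalemxAr opprD !addrA subrK.
have e1' : 0 < 1 - eps by rewrite subr_gt0.
rewrite -ler_sqr ?nnegrE ?mulr_ge0 ?sqrtr_ge0 ?norm2_ge0 // orth exprMn.
rewrite [CR ^+ 2]sqr_sqrtr; last first.
  have K0 : 0 <= (1 + eps) / (1 - eps) by apply: divr_ge0; lra.
  by rewrite addr_ge0 // divr_ge0 ?sqr_ge0 // mulr_ge0 ?sqr_ge0.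
rewrite mulrDl mul1r lerD2l.
have -> : (1 + eps) / (1 - eps) * N ^+ 2 / beta ^+ 2 * norm2 q ^+ 2 =
    ((1 + eps) * (N ^+ 2 * norm2 q ^+ 2)) / (beta ^+ 2 * (1 - eps)).
  by field; rewrite !gt_eqF.
rewrite ler_pdivlMr ?mulr_gt0 ?exprn_gt0 //; apply: le_trans hd.
by rewrite mulrCA ler_wpM2l ?sqr_ge0 // mulrC.
Qed.

(** * The shifted inverse and the error of the Ritz value *)

Lemma not_eigenvalue_unitmx (F : fieldType) n (A : 'M[F]_n) a :
  ~~ eigenvalue A a -> A - a%:M \in unitmx.
Proof. by rewrite negbK kermx_eq0 row_free_unit. Qed.

Lemma resolvent_eigenvector (F : fieldType) n (A : 'M[F]_n) (lam tau : F)
    (x : 'cV[F]_n) :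
  A - tau%:M \in unitmx -> x != 0 -> A *m x = lam *: x ->
  lam != tau /\ invmx (A - tau%:M) *m x = (lam - tau)^-1 *: x.
Proof.
move=> Mu x0 Ax.
have Mx : x = (lam - tau) *: (invmx (A - tau%:M) *m x).
  by rewrite scalemxAr scalerBl -Ax -mul_scalar_mx -mulmxBl mulKmx.
have lt : lam != tau.
  by apply: contraNneq x0 => lt; rewrite Mx lt subrr scale0r.
by split=> //; rewrite {2}Mx scalerA mulVf ?subr_eq0 // scale1r.
Qed.

Lemma resolvent_sub_eigenvalue (F : fieldType) n (A : 'M[F]_n) (lam tau : F) :
  A - tau%:M \in unitmx -> lam != tau ->
  invmx (A - tau%:M) - (lam - tau)^-1%:M =
  - (lam - tau)^-1 *: (invmx (A - tau%:M) *m (A - lam%:M)).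
Proof.
move=> Mu lt.
have -> : A - lam%:M = (A - tau%:M) - (lam - tau)%:M.
  by rewrite raddfB /= opprB addrA subrK.
rewrite mulmxBr mulVmx // mul_mx_scalar scalerBr scalerA mulNr mulVf ?subr_eq0 //.
by rewrite !scaleNr scale1r opprK addrC scalemx1.
Qed.

(* [(B - mustar) u] only sees [u] up to multiples of the eigenvector, so the
   residual is controlled by the eigenvector error of [u]. *)
Lemma ritz_value_error (R : realType) n s (S : 'M[R[i]]_(s, n))
    (B : 'M[R[i]]_n) (mu mustar g : R[i]) (x u : 'cV[R[i]]_n) (eps c : R)
    (E : set 'cV[R[i]]_n) :
  0 < eps < 1 -> subspace_embedding S eps E ->
  E u -> E ((B - mustar%:M) *m u) ->
  norm2 (S *m u) = 1 -> (S *m u)^t* *m (S *m (B *m u)) = mu%:M ->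
  norm2 x = 1 -> B *m x = mustar *: x ->
  0 <= c -> (forall v, norm2 ((B - mustar%:M) *m v) <= c * norm2 v) ->
  normc (mu - mustar) <= (1 + eps) / (1 - eps) * c * norm2 (x - g *: u).
Proof.
move=> /andP[e0 e1] emb Eu EBu u1 Bu x1 Bx c0 cP.
have uu : (S *m u)^t* *m (S *m u) = 1%:M.
  by rewrite [LHS]mx11_scalar -norm2_sqrC u1 expr1n.
have muE : (mu - mustar)%:M =
    (S *m u)^t* *m (S *m ((B - mustar%:M) *m u)) :> 'M_1.
  rewrite mulmxBl !mulmxBr Bu mul_scalar_mx -!scalemxAr uu scalemx1.
  by rewrite raddfB.
have h1 : normc (mu - mustar) <= norm2 (S *m ((B - mustar%:M) *m u)).
  apply: le_trans (norm2_adj_isometry _ uu); rewrite -muE norm2_cV1.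
  by rewrite mxE mulr1n.
have BuE : (B - mustar%:M) *m u =
    (B - mustar%:M) *m (u - (x^t* *m u) 0 0 *: x).
  by rewrite [RHS]mulmxBr -scalemxAr [_ *m x]mulmxBl Bx mul_scalar_mx
    subrr scaler0 subr0.
have h2 : norm2 ((B - mustar%:M) *m u) <= c * (norm2 u * norm2 (x - g *: u)).
  by rewrite BuE (le_trans (cP _)) // ler_wpM2l // norm2_sub_proj.
have /andP[+ _] := emb _ Eu; have /andP[_ +] := emb _ EBu; rewrite u1 expr1n.
have := normc_ge0 (mu - mustar); have := norm2_ge0 u.
have := norm2_ge0 (x - g *: u); have := norm2_ge0 ((B - mustar%:M) *m u).
move: (normc _) (norm2 (S *m _)) (norm2 (_ *m u)) (norm2 u) (norm2 (x - _))
  h1 h2 => a b r k d ab rb r0 d0 k0 a0 h3 h4.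
have e1' : 0 < 1 - eps by rewrite subr_gt0.
rewrite -ler_sqr ?nnegrE ?mulr_ge0 ?invr_ge0 //; try lra.
have -> : ((1 + eps) / (1 - eps) * c * d) ^+ 2 =
    ((1 + eps) ^+ 2 * (c * d) ^+ 2) / (1 - eps) ^+ 2.
  by field; rewrite gt_eqF.
rewrite ler_pdivlMr ?exprn_gt0 //.
have a2 : a ^+ 2 <= b ^+ 2 by rewrite ler_sqr ?nnegrE //; lra.
have r2 : r ^+ 2 <= k ^+ 2 * (c * d) ^+ 2.
  by rewrite -exprMn mulrCA ler_sqr ?nnegrE ?mulr_ge0.
have a3 : a ^+ 2 <= (1 + eps) * (k ^+ 2 * (c * d) ^+ 2).
  by apply: le_trans a2 (le_trans h3 _); rewrite ler_wpM2l //; lra.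
have cd := sqr_ge0 (c * d).
apply: (@le_trans _ _ ((1 + eps) * (k ^+ 2 * (c * d) ^+ 2) * (1 - eps) ^+ 2)).
  by rewrite ler_wpM2r ?sqr_ge0.
have -> : (1 + eps) * (k ^+ 2 * (c * d) ^+ 2) * (1 - eps) ^+ 2 =
  (((1 - eps) * k ^+ 2) * (1 - eps)) * ((1 + eps) * (c * d) ^+ 2) by ring.
have -> : (1 + eps) ^+ 2 * (c * d) ^+ 2 =
  (1 + eps) * ((1 + eps) * (c * d) ^+ 2) by ring.
rewrite ler_wpM2r //; first by rewrite mulr_ge0 //; lra.
(* The embedding yields the square root of [(1 + eps) / (1 - eps)]; [1 - eps <= 1 + eps] relaxes it
   to the ratio itself. *)
apply: (@le_trans _ _ (1 * (1 - eps))); last lra.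
by rewrite ler_wpM2r // ltW.
Qed.

(* From [theta - lam = (mustar - mu) / (mu mustar)] and [|mu| >= |mustar| / 2]. *)
Lemma inverse_shift_error (R : realType) (theta lam tau : R[i]) :
  theta != tau -> lam != tau ->
  normc ((theta - tau)^-1 - (lam - tau)^-1) <= normc (lam - tau)^-1 / 2 ->
  normc (theta - lam) * normc (lam - tau)^-1 ^+ 2 <=
  2 * normc ((theta - tau)^-1 - (lam - tau)^-1).
Proof.
rewrite -(subr_eq0 theta) -(subr_eq0 lam) => t0 l0.
set mu := _^-1; set ms := (lam - tau)^-1 => h.
have E : (theta - lam) * (mu * ms) = ms - mu.
  rewrite /mu /ms; have -> : theta - lam = (theta - tau) - (lam - tau) by ring.
  by field; rewrite t0 l0.
have EN : normc (theta - lam) * (normc mu * normc ms) = normc (mu - ms).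
  by rewrite -!normcM E -normcN opprB.
have h2 : normc ms <= normc (mu - ms) + normc mu.
  have {1}-> : ms = - (mu - ms) + mu by ring.
  by rewrite -[normc (mu - ms)]normcN; exact: le_normcD.
have h3 : normc ms <= 2 * normc mu by lra.
rewrite -EN; have := normc_ge0 ms; have := normc_ge0 (theta - lam).
move: (normc ms) (normc mu) (normc (theta - lam)) h3 => M m t h3 t0' M0.
have -> : 2 * (t * (m * M)) = t * ((2 * m) * M) by ring.
by rewrite ler_wpM2l // expr2 ler_wpM2r.
Qed.

(** * Passage to the angle and assembly of the constants *)

(** After division by [L], a bound valid for every [c] passes to the infimum; for [L = 0] the case
    [c = 0] is already the claim. *)
Lemma sin_angle_lb (R : realType) n k (x : 'cV[R[i]]_n) (V : 'M[R[i]]_(n, k))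
    (L e : R) : norm2 x = 1 -> 0 <= L ->
  (forall c, e <= L * norm2 (x - V *m c)) -> e <= L * sin_angle x V.
Proof.
move=> x1 L0 h; have [L00|Ln0] := eqVneq L 0.
  by have := h 0; rewrite L00 !mul0r.
have L_gt0 : 0 < L by rewrite lt_def Ln0.
rewrite -ler_pdivrMl //; apply: lb_le_inf.
  by exists (norm2 (x - V *m 0) / norm2 x), (V *m 0) => //; exists 0.
move=> _ [_ [c _ <-] <-]; rewrite x1 divr1 ler_pdivrMl //; exact: h.
Qed.

Lemma colspan_row_mxD (R : realType) n k l (V : 'M[R[i]]_(n, k))
    (W : 'M[R[i]]_(n, l)) c d : colspan (row_mx V W) (V *m c + W *m d).
Proof. by exists (col_mx c d) => //; rewrite mul_row_col. Qed.

Unset Implicit Arguments.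

Theorem theorem5p2 (R : realType) (n s m : nat)
    (A : 'M[R[i]]_n) (lam : R[i]) (xR xL : 'cV[R[i]]_n)
    (V : 'M[R[i]]_(n, m.+1)) (S : 'M[R[i]]_(s, n)) (eps : R) (tau : R[i])
    (theta : R[i]) (y : 'cV[R[i]]_m.+1) (beta : R) :
  let B := invmx (A - tau%:M) in
  let W := (A - tau%:M) *m V in
  let uhat := W *m y in
  let mu := (theta - tau)^-1 in
  let mustar := (lam - tau)^-1 in
  let rho := sin_angle xR V in
  let nu := norm2 ((A^t* - (lam^*)%:M) *m xR) in
  let Keps := (1 + eps) / (1 - eps) in
  let CR := Num.sqrt
    (1 + Keps * spectral_norm (B - mustar%:M) ^+ 2 / beta ^+ 2) in
  let Mlam := nu + (1 + eps) * spectral_norm (A - lam%:M) in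
  let Ltheta := 2 * kappa2 (A - tau%:M) * CR * Mlam / (1 - eps) in
  simple_eigentriplet A lam xR xL ->
  norm2 xL = 1 -> norm2 xR = 1 ->
  sketch_orthonormal S V ->
  0 < eps < 1 ->
  subspace_embedding S eps (colspan (row_mx V (A *m V))) ->
  ~~ eigenvalue A tau ->
  sketched_harmonic_pair S A V tau theta y ->
  norm2 (S *m uhat) = 1 ->
  0 < beta ->
  separation_condition S B W mu uhat mustar beta ->
  normc (mu - mustar) <= normc mustar / 2 ->
  normc (theta - lam) <= Ltheta * rho.
Proof.
(* In dimension 0 no vector has norm 1. *)
case: n A xR xL V S => [|n] A xR xL V S.
  move=> B W uhat mu mustar rho nu Keps CR Mlam Ltheta _ _.
  by rewrite /norm2 big_ord0 sqrtr0 => /esym/eqP; rewrite oner_eq0.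
move=> B W uhat mu mustar rho nu Keps CR Mlam Ltheta.
move=> [_ x0 _ Ax _] _ x1 _ e01 emb tauA [_ theta_tau _] u1 b0.
move=> [Q [z [Zperp [H12 [H22 [[SQ QW] uE Uu HRU bH]]]]]] mumu.
have Mu : A - tau%:M \in unitmx by exact: not_eigenvalue_unitmx.
have [lam_tau Bx] := resolvent_eigenvector Mu x0 Ax.
rewrite -/B -/mustar in Bx.
have [c_min c0 cE] := sigma_min_unitmx Mu.
have [e0 e1] := andP e01; have e1' : 0 < 1 - eps by rewrite subr_gt0.
have ms0 : mustar != 0 by rewrite invr_eq0 subr_eq0.
have nms0 : 0 < normc mustar.
  by rewrite lt_def normc_ge0 andbT; apply: contra ms0 => /eqP/eq0_normc ->.
have WE c : W *m c = V *m (- tau *: c) + (A *m V) *m c.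
  rewrite /W mulmxBl mulmxBl mul_scalar_mx addrC -scalemxAr -scalemxAl.
  by rewrite scaleNr.
have BW c : B *m (W *m c) = V *m c by rewrite /W -mulmxA mulKmx.
have EW c : colspan (row_mx V (A *m V)) (W *m c).
  by rewrite WE; exact: colspan_row_mxD.
(* [B] maps [W *m c] back to [V *m c], so the residual stays in the span of [V] and [A *m V], where
   the embedding holds. *)
have EBW c : colspan (row_mx V (A *m V)) ((B - mustar%:M) *m (W *m c)).
  rewrite mulmxBl BW mul_scalar_mx WE scalerDr opprD addrA !scalemxAr.
  by rewrite -mulmxBr -mulmxN; exact: colspan_row_mxD.
have QWc (c : 'cV_m.+1) : exists c', Q *m c = W *m c'.
  have : colspan W (Q *m c) by rewrite -QW; exists c.
  by move=> [c' _ <-]; exists c'.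
have EQ c : colspan (row_mx V (A *m V)) (Q *m c) by have [c' ->] := QWc c.
have EBQ c : colspan (row_mx V (A *m V)) ((B - mustar%:M) *m (Q *m c)).
  by have [c' ->] := QWc c.
have [g gP] := ritz_vector_error e01 b0 emb EQ EBQ SQ Uu HRU bH Bx.
rewrite -uE -/Keps -/CR in gP.
(* The upper left entry of the block form is the sketched Rayleigh quotient of [uhat]. *)
have Bu : (S *m uhat)^t* *m (S *m (B *m uhat)) = mu%:M.
  have UU := unitarymxP Uu.
  have [<- _ _ _] :=
    @unitary_block_compression _ m.+1 1 m z Zperp _ _ _ _ UU (mulmx1C UU) HRU.
  by rewrite uE !adjmxM -!mulmxA.
pose a := spectral_norm (A - lam%:M).
have a0 : 0 <= a by exact: spectral_norm_ge0.
have Binv v : norm2 (B *m v) <= c_min^-1 * norm2 v.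
  have cmin : (c_min%:E <= sigma_min (A - tau%:M)%R)%E by rewrite cE.
  have := norm2_ge_sigma_min (B *m v) (ltW c0) cmin.
  by rewrite mulKVmx // ler_pdivlMl.
(* The bound [c_min^-1] on [B] supplies the denominator of [kappa2]; its numerator comes from
   [xw]. *)
have Bres v : norm2 ((B - mustar%:M) *m v) <=
    normc mustar * c_min^-1 * a * norm2 v.
  rewrite /B /mustar resolvent_sub_eigenvalue // -/mustar -/B -scalemxAl norm2Z.
  rewrite normcN -!mulrA ler_wpM2l ?normc_ge0 // -mulmxA.
  apply: le_trans (Binv _) _; rewrite ler_wpM2l ?invr_ge0 ?(ltW c0) //.
  exact: norm2_le_spectral_norm.
have c0' : 0 <= normc mustar * c_min^-1 * a.
  by rewrite !mulr_ge0 ?normc_ge0 ?invr_ge0 // ltW.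
have ritz := ritz_value_error g e01 emb (EW y) (EBW y) u1 Bu x1 Bx c0' Bres.
have shift := inverse_shift_error theta_tau lam_tau mumu.
have smax0 : 0 <= sigma_max (A - tau%:M).
  have := norm2_le_sigma_max (A - tau%:M) xR; rewrite x1 mulr1.
  exact: le_trans (norm2_ge0 _).
have CR0 : 0 <= CR by exact: sqrtr_ge0.
have nu0 : 0 <= nu by exact: norm2_ge0.
have k0 : 0 <= 2 * (sigma_max (A - tau%:M) / c_min) * CR / (1 - eps).
  by rewrite !mulr_ge0 ?invr_ge0 // ltW.
have LE : Ltheta = 2 * (sigma_max (A - tau%:M) / c_min) * CR / (1 - eps) * Mlam.
  by rewrite /Ltheta /kappa2 cE /=; ring.
have M0 : (1 + eps) * a <= Mlam by rewrite lerDr.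
have L1 : 0 <= (1 + eps) * a by rewrite mulr_ge0 // addr_ge0 // ltW.
apply: (sin_angle_lb x1) => [|c].
  by rewrite LE mulr_ge0 //; exact: le_trans M0.
apply: (@le_trans _ _ (2 * (sigma_max (A - tau%:M) / c_min) * CR / (1 - eps) *
    ((1 + eps) * a) * norm2 (xR - V *m c))); last first.
  by rewrite LE ler_wpM2r ?norm2_ge0 // ler_wpM2l.
have xw : norm2 (xR - g *: uhat) <=
    CR * (normc mustar * (sigma_max (A - tau%:M) * norm2 (xR - V *m c))).
  (* The competitor in [W] is the image of [mustar *: c], because
     [xR = mustar *: ((A - tau%:M) *m xR)]. *)
  have [c' cE'] : exists c', Q *m c' = W *m (mustar *: c).
    have : colspan Q (W *m (mustar *: c)) by rewrite QW; exists (mustar *: c).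
    by move=> [c' _ <-]; exists c'.
  apply: le_trans (gP c') _; rewrite ler_wpM2l // cE'.
  have -> : xR - W *m (mustar *: c) =
      mustar *: ((A - tau%:M) *m (xR - V *m c)).
    rewrite mulmxBr [_ *m xR]mulmxBl Ax mul_scalar_mx -scalerBl scalerBr.
    by rewrite scalerA mulVf ?subr_eq0 // scale1r /W -mulmxA -!scalemxAr.
  by rewrite norm2Z ler_wpM2l ?normc_ge0 // norm2_le_sigma_max.
have K0 : 0 <= (1 + eps) / (1 - eps) * (normc mustar * c_min^-1 * a).
  by rewrite mulr_ge0 // divr_ge0 //; lra.
have mu_err := le_trans ritz (ler_wpM2l K0 xw).
rewrite -(ler_pM2r (exprn_gt0 2 nms0)); apply: (le_trans shift).
(* Here [t] is [normc mustar]: one factor comes from [Bres], one from [xw], and together they match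
   the square introduced by [shift]. The [1 + eps] of the Ritz value bound moves next to [a]. *)
have alg (t ci b r M d : R) :
    2 * ((1 + eps) / (1 - eps) * (t * ci * b) * (r * (t * (M * d)))) =
    2 * (M * ci) * r / (1 - eps) * ((1 + eps) * b) * d * t ^+ 2.
  by ring.
by have := ler_wpM2l (ler0n R 2) mu_err; rewrite alg.
Qed.
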